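(* There exists a Heffter array $H(n;k)$ for all $n\equiv 3\pmod 4$ and $k\equiv 3\pmod 4$ with $n>k\ge 3$.
   Context: A Heffter array $H(n;k)$ is an $n\times n$ array in which some cells are filled with nonzero integers and the others are empty, such that: each row and each column contains exactly $k$ filled cells; the entries of every row and of every column sum to $0$ modulo $2nk+1$; and for each integer $1\le x\le nk$, exactly one of $x$ or $-x$ appears in the array, and it appears exactly once. *)

(* Defs.v *)
From HB Require Import structures.
From mathcomp Require Import all_boot all_order all_algebra.
Set Implicit Arguments. Unset Strict Implicit. Unset Printing Implicit Defensive.
Import Order.TTheory GRing.Theory Num.Theory.
Local Open Scope ring_scope.

(* An n x n partially filled integer array: None = empty cell. *)
Definition parray (n : nat) := 'I_n -> 'I_n -> option int.

Definition cellv (o : option int) : int := if o is Some z then z else 0.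

Definition is_heffter (n k : nat) (A : parray n) : Prop :=
  (forall i : 'I_n, #|[set j : 'I_n | A i j != None]| = k) /\
  (forall j : 'I_n, #|[set i : 'I_n | A i j != None]| = k) /\
  (forall i j : 'I_n, forall z, A i j = Some z -> z != 0) /\
  (forall i : 'I_n,
      ((\sum_(j < n) cellv (A i j)) %% (2 * n * k + 1)%:Z)%Z = 0) /\
  (forall j : 'I_n,
      ((\sum_(i < n) cellv (A i j)) %% (2 * n * k + 1)%:Z)%Z = 0) /\
  (forall i j : 'I_n, forall z, A i j = Some z ->
      (1 <= `|z|%N <= n * k)%N) /\
  (forall x : nat, (1 <= x <= n * k)%N ->
      #|[set p : 'I_n * 'I_n |
          (A p.1 p.2 == Some (x%:Z)) || (A p.1 p.2 == Some (- (x%:Z)))]| = 1%N).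

Definition heffter_exists (n k : nat) : Prop :=
  exists A : parray n, @is_heffter n k A.

(* Main.v *)
(*
  Write k = 4m + 3 and s = 4mn.  A base array occupies three cells in each line,
  all within distance 3 of the main diagonal, and uses the absolute values 1, ..., t
  and t + s + 1, ..., 3n + s.  The gap of length s is filled on the diagonals
  4, ..., k: two consecutive cyclic diagonals carry consecutive integers with
  alternating signs along the closed staircase they form, and pairing two such
  staircases of opposite sign makes every line sum vanish.

  Modulo 2nk + 1 = 6n + 1 + 2s a base line sums to 0 for every s as soon as its sum
  is x(6n + 1) and its signed number of large entries is 2x, with x in {0, 1, -1}.
  For n = 8u + r with r = 7 or r = 11, the base array is block diagonal: u blocks of
  order 8 whose entries are affine in u and in the index of the block, and one
  corner of order r whose entries are affine in u.  The absolute values then form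
  arithmetic progressions, and that they are pairwise disjoint is a finite check
  on the coefficients.
*)
Require Import Defs.
From mathcomp Require Import all_boot all_order all_algebra.
From mathcomp Require Import zify ring.
Set Implicit Arguments. Unset Strict Implicit. Unset Printing Implicit Defensive.
Import Order.TTheory GRing.Theory Num.Theory.

Local Open Scope nat_scope.

(** * Heffter arrays from functions on natural indices *)

Definition filled (T : Type) (o : option T) : nat := isSome o.

(** Distinct absolute values suffice: the rows give [n * k] filled cells, so an injective map from
    them to 1, ..., [n * k] is onto, and every [x] is attained exactly once. *)
Lemma heffter_of_fun (n k : nat) (A : nat -> nat -> option int) :
  (forall i, i < n -> \sum_(0 <= j < n) filled (A i j) = k) ->
  (forall j, j < n -> \sum_(0 <= i < n) filled (A i j) = k) ->
  (forall i, i < n ->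
     ((2 * n * k + 1)%:Z %| (\sum_(0 <= j < n) cellv (A i j))%R)%Z) ->
  (forall j, j < n ->
     ((2 * n * k + 1)%:Z %| (\sum_(0 <= i < n) cellv (A i j))%R)%Z) ->
  (forall i j z, i < n -> j < n -> A i j = Some z -> 1 <= `|z| <= n * k) ->
  (forall i j i' j' z z', i < n -> j < n -> i' < n -> j' < n ->
     A i j = Some z -> A i' j' = Some z' -> `|z| = `|z'| ->
     i = i' /\ j = j') ->
  heffter_exists n k.
Proof.
move=> rowk colk row0 col0 bnd inj; exists (fun i j : 'I_n => A i j).
have cardE (P : pred 'I_n) (f : nat -> option int) :
    (forall i : 'I_n, P i = (f i != None)) ->
    #|[set i | P i]| = \sum_(0 <= i < n) filled (f i).
  move=> Pf; rewrite big_mkord -sum1_card big_mkcond /=.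
  by apply: eq_bigr => i _; rewrite inE Pf /filled; case: (f i).
have rows (i : 'I_n) : #|[set j : 'I_n | A i j != None]| = k.
  by rewrite (cardE _ (A i)) ?rowk.
split=> //; split.
  by move=> j; rewrite (cardE _ (fun i => A i j)) ?colk.
split; first by move=> i j z /bnd-/(_ (ltn_ord i) (ltn_ord j)); lia.
split.
  by move=> i; apply/eqP; move/dvdz_mod0P: (row0 i (ltn_ord i)); rewrite big_mkord => ->.
split.
  by move=> j; apply/eqP; move/dvdz_mod0P: (col0 j (ltn_ord j)); rewrite big_mkord => ->.
split; first by move=> i j z /bnd-/(_ (ltn_ord i) (ltn_ord j)).
pose cells := [set p : 'I_n * 'I_n | A p.1 p.2 != None].
have card_cells : #|cells| = n * k.
  rewrite -sum1_card (eq_bigl (fun p : 'I_n * 'I_n => true && (A p.1 p.2 != None)));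
    last by move=> p; rewrite inE.
  rewrite -(pair_big_dep xpredT (fun i j : 'I_n => A i j != None) (fun _ _ => 1)) /=.
  rewrite (eq_bigr (fun _ => k)); first by rewrite sum_nat_const card_ord.
  by move=> i _; rewrite -(rows i) -sum1_card; apply: eq_bigl => j; rewrite inE.
pose f (p : 'I_n * 'I_n) : 'I_(n * k).+1 := inord `|cellv (A p.1 p.2)|.
have fE p : p \in cells -> exists2 z, A p.1 p.2 = Some z & f p = `|z| :> nat.
  rewrite inE; case E: (A _ _) => [z|//] _; exists z => //.
  by rewrite /f E /= inordK // ltnS; case/andP: (bnd _ _ _ (ltn_ord _) (ltn_ord _) E).
have finj : {in cells &, injective f}.
  move=> [i j] [i' j'] /fE[z /= Az fz] /fE[z' /= Az' fz'] ff.
  have zz : `|z| = `|z'| by rewrite -fz -fz' ff.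
  by have [/val_inj-> /val_inj->] :=
    inj _ _ _ _ _ _ (ltn_ord i) (ltn_ord j) (ltn_ord i') (ltn_ord j') Az Az' zz.
(* By cardinality, the image misses only 0 among the [n * k + 1] ordinals. *)
have fim : f @: cells = [set~ ord0].
  apply/eqP; rewrite eqEcard card_in_imset // card_cells cardsC1 card_ord leqnn andbT.
  apply/subsetP => _ /imsetP[p /fE[z Az fz] ->]; rewrite !inE -val_eqE /= fz.
  by have := bnd _ _ _ (ltn_ord _) (ltn_ord _) Az; lia.
move=> x /andP[x1 xn].
have : (inord x : 'I_(n * k).+1) \in f @: cells.
  by rewrite fim !inE -val_eqE /= inordK //; lia.
case/imsetP=> p pc xp; have [z Az fz] := fE p pc.
have xz : x = `|z| by rewrite -fz -xp inordK.
rewrite (_ : [set _ | _] = [set p]) ?cards1 //; apply/setP => q; rewrite !inE.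
apply/idP/eqP => [|->]; last first.
  by rewrite Az; have [z0|z0] := lerP 0%R z; apply/orP; [left|right]; apply/eqP; congr Some; lia.
move=> qx; have [y Ay] : exists2 y, A q.1 q.2 = Some y & `|y| = x.
  by case/orP: qx => /eqP->; eexists; try reflexivity; lia.
move=> yx; have qc : q \in cells by rewrite inE Ay.
apply: (finj _ _ qc pc); apply: val_inj.
by rewrite /= fz /f Ay /= inordK ?yx //; lia.
Qed.

(** * Reading rows and columns along cyclic diagonals *)

Section CyclicReindexing.
Variables (T : Type) (idx : T) (op : Monoid.com_law idx).

Lemma big_shift n i (h : nat -> T) : i < n ->
  \big[op/idx]_(0 <= j < n) h j = \big[op/idx]_(0 <= d < n) h ((i + d) %% n).
Proof.
move=> ltin; have n0 : 0 < n by lia.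
rewrite !big_mkord; pose f (d : 'I_n) := Ordinal (ltn_pmod (i + d) n0).
rewrite (reindex_inj (h := f)) //= => d d' /(congr1 val) /= dd'.
apply/val_inj/eqP => /=.
by rewrite -(modn_small (ltn_ord d)) -(modn_small (ltn_ord d')) -(eqn_modDl i) dd'.
Qed.

Lemma big_reflect n j (h : nat -> T) : j < n ->
  \big[op/idx]_(0 <= i < n) h i =
  \big[op/idx]_(0 <= d < n) h ((j + n - d) %% n).
Proof.
move=> ltjn; have n0 : 0 < n by lia.
rewrite !big_mkord; pose f (d : 'I_n) := Ordinal (ltn_pmod (j + n - d) n0).
rewrite (reindex_inj (h := f)) //= => d d' /(congr1 val) /= dd'.
apply/val_inj/eqP => /=.
rewrite -(modn_small (ltn_ord d)) -(modn_small (ltn_ord d')).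
(* Adding [d + d'] to both residues removes the truncated subtractions, and the congruence can be
   cancelled. *)
have Ed : j + n - d + (d + d') = j + n + d' by have := ltn_ord d; lia.
have Ed' : j + n - d' + (d + d') = j + n + d by have := ltn_ord d'; lia.
rewrite -(eqn_modDl (j + n)) -Ed -Ed' eq_sym.
by apply/eqP; rewrite -modnDml dd' modnDml.
Qed.

Lemma big_quadruples m (h : nat -> T) :
  \big[op/idx]_(0 <= d < 4 * m) h d =
  \big[op/idx]_(0 <= a < m)
    op (op (h (4 * a)) (h (4 * a + 1))) (op (h (4 * a + 2)) (h (4 * a + 3))).
Proof.
elim: m => [|m IHm]; first by rewrite muln0 !big_nil.
rewrite [RHS]big_nat_recr // -IHm (_ : 4 * m.+1 = (4 * m).+4); last by lia.
by rewrite !big_nat_recr //= !addnS addn0 !Monoid.mulmA.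
Qed.

(** Four consecutive diagonals, that is two staircases, form the unit within which the filler sums
    cancel. *)
Lemma big_diagonals n m (h : nat -> T) : 4 * m + 4 <= n ->
  (forall d, d < n -> ~~ (4 <= d <= 4 * m + 3) -> h d = idx) ->
  \big[op/idx]_(0 <= d < n) h d =
  \big[op/idx]_(0 <= a < m)
    op (op (h (4 * a + 4)) (h (4 * a + 5))) (op (h (4 * a + 6)) (h (4 * a + 7))).
Proof.
move=> mn h0.
rewrite (big_cat_nat (n := 4)) //=; last by lia.
rewrite [X in op X _]big_nat big1 => [|d d4]; last by apply: h0; lia.
rewrite Monoid.mul1m (big_cat_nat (n := 4 * m + 4)) //=; last by lia.
rewrite [X in op _ X]big_nat [X in op _ X]big1 => [|d d4]; last by apply: h0; lia.
rewrite Monoid.mulm1 -{1}[4]add0n big_addn addnK big_quadruples.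
by apply: eq_bigr => a _; rewrite -!addnA.
Qed.

End CyclicReindexing.

(** * The filler on the diagonals 4, ..., 4m + 3 *)

Definition in_band (i j : nat) := (i <= j + 3) && (j <= i + 3).

(* The offset d = j - i (mod n) selects the staircase (d - 4)./2, formed by the
   diagonals d and d + 1 for even d.  Its cell in column j comes at place
   2j if d is even and at place 2(j - 1 mod n) + 1 if d is odd, so that all the
   staircases close up in the same column and the jumps there cancel in pairs. *)
Definition filler_abs n t d j :=
  t + 1 + 2 * n * (d - 4)./2 + 2 * ((j + odd d * (n - 1)) %% n) + odd d.

(** On the diagonals 4a + 4, ..., 4a + 7 the signs are +, -, -, +. They alternate along each
    staircase, and the two staircases have opposite signs. *)
Definition filler n m t i j : option int :=
  let d := (j + n - i) %% n in
  if 4 <= d <= 4 * m + 3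
  then Some ((-1) ^+ (d./2 + odd d) * (filler_abs n t d j)%:Z)%R else None.

Lemma offset_row n i d : i < n -> d < n -> ((i + d) %% n + n - i) %% n = d.
Proof.
move=> ltin ltdn; have [lt_n|le_n] := ltnP (i + d) n.
  rewrite (modn_small lt_n) (_ : i + d + n - i = d + n); last by lia.
  by rewrite modnDr modn_small.
have -> : (i + d) %% n = i + d - n.
  by rewrite -{1}(subnK le_n) modnDr modn_small //; lia.
by rewrite (_ : i + d - n + n - i = d) ?modn_small //; lia.
Qed.

Lemma offset_col n j d : j < n -> d < n -> (j + n - (j + n - d) %% n) %% n = d.
Proof.
move=> ltjn ltdn; have [lejd|ltjd] := leqP d j.
  have -> : (j + n - d) %% n = j - d.
    by rewrite (_ : j + n - d = j - d + n) ?modnDr ?modn_small //; lia.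
  by rewrite (_ : j + n - (j - d) = d + n) ?modnDr ?modn_small //; lia.
rewrite (modn_small (_ : j + n - d < n)); last by lia.
by rewrite (_ : j + n - (j + n - d) = d) ?modn_small //; lia.
Qed.

Lemma odd_quadruple a b : (odd (4 * a + b) = odd b) *
  (odd ((4 * a + b)./2 + odd (4 * a + b)) = odd (b./2 + odd b)).
Proof.
have oddE : odd (4 * a + b) = odd b by rewrite oddD oddM.
have halfE : (4 * a + b)./2 = 2 * a + b./2 by lia.
by rewrite oddE halfE -addnA oddD oddM.
Qed.

Section Filler.
Variables (n m t : nat).
Hypothesis mn : 4 * m + 7 <= n.

Lemma filler_row_count i : i < n ->
  \sum_(0 <= j < n) filled (filler n m t i j) = 4 * m.
Proof.
move=> ltin; rewrite (big_shift _ _ ltin) (@big_diagonals _ _ _ n m) //=; first last.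
- by move=> d dn; rewrite /filler offset_row // => /negbTE->.
- by lia.
rewrite big_nat (eq_bigr (fun _ => 4)) => [|a am]; last first.
  by rewrite /filler !offset_row //; try lia; rewrite !ifT //; lia.
by rewrite -big_nat sum_nat_const_nat; lia.
Qed.

Lemma filler_col_count j : j < n ->
  \sum_(0 <= i < n) filled (filler n m t i j) = 4 * m.
Proof.
move=> ltjn; rewrite (big_reflect _ _ ltjn) (@big_diagonals _ _ _ n m) //=; first last.
- by move=> d dn; rewrite /filler offset_col // => /negbTE->.
- by lia.
rewrite big_nat (eq_bigr (fun _ => 4)) => [|a am]; last first.
  by rewrite /filler !offset_col //; try lia; rewrite !ifT //; lia.
by rewrite -big_nat sum_nat_const_nat; lia.
Qed.

(** In a row, the diagonals d and d + 1 of a staircase (d even) carry consecutive integers. The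
    signs +, -, -, + make the two staircases of a group contribute -1 and +1. *)
Lemma filler_row_sum i : i < n ->
  (\sum_(0 <= j < n) cellv (filler n m t i j) = 0)%R.
Proof.
move=> ltin; rewrite (big_shift _ _ ltin) (@big_diagonals _ _ _ n m) //=; first last.
- by move=> d dn; rewrite /filler offset_row // => /negbTE->.
- by lia.
rewrite big_nat big1 // => a am.
rewrite /filler !offset_row //; try lia; rewrite !ifT /cellv; try lia.
rewrite -![((-1) ^+ (_ + _))%R]signr_odd !odd_quadruple /filler_abs !odd_quadruple /=.
have-> : (4 * a + 4 - 4)./2 = 2 * a by lia.
have-> : (4 * a + 5 - 4)./2 = 2 * a by lia.
have-> : (4 * a + 6 - 4)./2 = 2 * a + 1 by lia.
have-> : (4 * a + 7 - 4)./2 = 2 * a + 1 by lia.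
(* In a fixed row, the step back by one column on the odd diagonal leads to the place used on the
   even diagonal before it. *)
have E d : ((i + d.+1) %% n + 1 * (n - 1)) %% n = ((i + d) %% n + 0 * (n - 1)) %% n.
  rewrite !modnDml !(mul1n, mul0n, addn0) (_ : i + d.+1 + (n - 1) = i + d + n); last by lia.
  by rewrite modnDr.
rewrite (_ : 4 * a + 5 = (4 * a + 4).+1) ?E; last by lia.
rewrite (_ : 4 * a + 7 = (4 * a + 6).+1) ?E; last by lia.
by lia.
Qed.

(** In a column, the place depends only on the parity of d. So the absolute values on d and d + 2
    differ by 2n for both parities, and the signs make these differences cancel. *)
Lemma filler_col_sum j : j < n ->
  (\sum_(0 <= i < n) cellv (filler n m t i j) = 0)%R.
Proof.
move=> ltjn; rewrite (big_reflect _ _ ltjn) (@big_diagonals _ _ _ n m) //=; first last.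
- by move=> d dn; rewrite /filler offset_col // => /negbTE->.
- by lia.
rewrite big_nat big1 // => a am.
rewrite /filler !offset_col //; try lia; rewrite !ifT /cellv; try lia.
rewrite -![((-1) ^+ (_ + _))%R]signr_odd !odd_quadruple /filler_abs !odd_quadruple /=.
have-> : (4 * a + 4 - 4)./2 = 2 * a by lia.
have-> : (4 * a + 5 - 4)./2 = 2 * a by lia.
have-> : (4 * a + 6 - 4)./2 = 2 * a + 1 by lia.
have-> : (4 * a + 7 - 4)./2 = 2 * a + 1 by lia.
by lia.
Qed.

Lemma fillerP i j z : filler n m t i j = Some z ->
  4 <= (j + n - i) %% n <= 4 * m + 3 /\
  `|z| = filler_abs n t ((j + n - i) %% n) j.
Proof. by rewrite /filler; case: ifP => // dP [<-]; rewrite abszMsign. Qed.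

(** There are 2m staircases, each with its own run of 2n integers, and together they span the gap of
    length 4mn. *)
Lemma filler_bounds i j z : filler n m t i j = Some z ->
  t < `|z| <= t + 4 * m * n.
Proof.
move=> /fillerP[]; move: (_ %% n) => d dP ->; rewrite /filler_abs.
have := @ltn_pmod (j + odd d * (n - 1)) n ltac:(lia).
move: (_ %% n) => p ltpn.
have : (d - 4)./2.+1 <= 2 * m by lia.
move/(leq_mul (leqnn (2 * n))); move: (_./2) => Q QP.
by case: (odd d) => /=; lia.
Qed.

(** Below the main diagonal the band has the offsets n - 3, ..., n - 1, which exceed 4m + 3 because
    4m + 7 <= n. *)
Lemma filler_offdiag i j z : i < n -> j < n -> filler n m t i j = Some z ->
  ~~ in_band i j.
Proof.
move=> ltin ltjn /fillerP[dP _]; apply/negP => /andP[ij ji].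
have [leij|ltji] := leqP i j.
  move: dP; rewrite (_ : j + n - i = j - i + n) ?modnDr ?modn_small; lia.
by move: dP; rewrite modn_small; lia.
Qed.

(** The absolute value is decoded digit by digit: parity gives [odd d], then division by n gives the
    staircase as quotient and the place as remainder. These determine d and the column, hence the
    row. *)
Lemma filler_inj i j i' j' z z' : i < n -> j < n -> i' < n -> j' < n ->
  filler n m t i j = Some z -> filler n m t i' j' = Some z' ->
  `|z| = `|z'| -> i = i' /\ j = j'.
Proof.
move=> ltin ltjn ltin' ltjn' /fillerP[dP ->] /fillerP[dP' ->].
have n0 : 0 < n by lia.
move Ed : ((j + n - i) %% n) dP => d dP; move Ed' : ((j' + n - i') %% n) dP' => d' dP'.
rewrite /filler_abs.
have := ltn_pmod (j + odd d * (n - 1)) n0; have := ltn_pmod (j' + odd d' * (n - 1)) n0.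
move Ep : ((j + _) %% n) => p; move Ep' : ((j' + _) %% n) => p' ltpn' ltpn eqX.
have eqodd : odd d = odd d'.
  have := congr1 odd eqX; rewrite !(oddD, oddM) /=.
  by case: (odd d) (odd d') (odd t) => [] [] [].
have eqnQ : (d - 4)./2 * n + p = (d' - 4)./2 * n + p'.
  move: eqX; rewrite eqodd => /addIn; rewrite -!(addnA (t + 1)) => /addnI.
  by rewrite -!mulnA -!mulnDr ![n * _]mulnC => /eqP; rewrite eqn_pmul2l // => /eqP.
have eqQ : (d - 4)./2 = (d' - 4)./2.
  by have := congr1 (divn^~ n) eqnQ; rewrite /= !divnMDl // !divn_small // !addn0.
have eqd : d = d' by clear -eqodd eqQ dP dP'; lia.
have eqp : p = p' by move: eqnQ; rewrite eqQ => /addnI.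
(* Adding back [b] undoes the cyclic step that defines the place, which recovers the column. *)
have jp (x y : nat) (b : bool) : x < n -> (x + b * (n - 1)) %% n = y -> (y + b) %% n = x.
  move=> ltxn <-; rewrite modnDml -addnA; case: b => /=; last by rewrite mul0n !addn0 modn_small.
  by rewrite mul1n subnK // modnDr modn_small.
have eqj : j = j'.
  by rewrite -(jp _ _ _ ltjn Ep) -(jp _ _ _ ltjn' Ep') eqp eqodd.
split=> //.
by rewrite -(offset_col ltjn ltin) Ed eqd -Ed' -eqj (offset_col ltjn ltin').
Qed.
End Filler.

(** * Entries with affine coefficients and their comparison *)

Section Entries.
Local Open Scope ring_scope.

(* In block a the entry has absolute value c0 + c1 u + c2 a, plus s if it is big. *)
Record entry := Entry { neg : bool; big : bool; c0 : int; c1 : int; c2 : int }.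

Definition small_part e (u a : nat) : int := c0 e + c1 e * u%:Z + c2 e * a%:Z.
Definition magnitude e u a (s : nat) : int := small_part e u a + (big e)%:Z * s%:Z.
Definition value e u a s : int := (-1) ^+ neg e * magnitude e u a s.

Definition lsum (f : entry -> int) (l : seq (option entry)) : int :=
  foldr (fun o x => (if o is Some e then (-1) ^+ neg e * f e else 0) + x) 0 l.

(** For n = 8u + r the modulus is (6r + 1) + 48u + 2s. The test asks coefficientwise that the line
    sum be x times it, hence holds uniformly in u, a and s. *)
Definition line_ok (r : nat) (l : seq (option entry)) : bool :=
  (count isSome l == 3)%N &&
  has (fun x : int => [&& lsum (fun e => (big e)%:Z) l == 2 * x,
                     lsum c0 l == x * (6 * r%:Z + 1),
                     lsum c1 l == 48 * x & lsum c2 l == 0]) [:: 0; 1; -1].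

Lemma line_sum l u a s :
  \sum_(o <- l) cellv (omap (fun e => value e u a s) o) =
  lsum c0 l + lsum c1 l * u%:Z + lsum c2 l * a%:Z +
  lsum (fun e => (big e)%:Z) l * s%:Z.
Proof.
elim: l => [|o l IHl]; rewrite ?big_nil ?big_cons /=; first by ring.
rewrite IHl; case: o => [e|] /=; last by ring.
by rewrite /value /magnitude /small_part; ring.
Qed.

Lemma line_filled r l : line_ok r l -> \sum_(o <- l) filled o = 3%N.
Proof.
case/andP=> /eqP<- _; rewrite -sum1_count [RHS]big_mkcond.
by apply: eq_bigr => -[].
Qed.

Lemma line_dvd r l u a s : line_ok r l ->
  ((6 * (8 * u + r) + 1 + 2 * s)%N%:Z %|
     \sum_(o <- l) cellv (omap (fun e => value e u a s) o))%Z.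
Proof.
case/andP=> _ /hasP[x _ /and4P[/eqP bE /eqP E0 /eqP E1 /eqP E2]].
apply/dvdzP; exists x; rewrite line_sum bE E0 E1 E2 !(PoszD, PoszM); ring.
Qed.

(** A pair (x, y) encodes the function x + yu. Comparing slopes and the values at u = m decides the
    inequality in a way valid for all u >= m. *)
Definition affine_lt (m : nat) (f g : int * int) : bool :=
  (f.2 <= g.2) && (f.1 + f.2 * m%:Z < g.1 + g.2 * m%:Z).

Lemma affine_ltP m (u : nat) f g : affine_lt m f g -> (m <= u)%N ->
  f.1 + f.2 * u%:Z < g.1 + g.2 * u%:Z.
Proof.
case/andP=> le2 lt1 leum.
have : 0 <= (g.2 - f.2) * (u%:Z - m%:Z) by apply: mulr_ge0; lia.
by move: lt1; lia.
Qed.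

(** Over 0 <= a < u the extremes of [small_part] occur at a = 0 and a = u - 1; substituting either
    one leaves an affine function of u. *)
Definition low e : int * int :=
  if 0 <= c2 e then (c0 e, c1 e) else (c0 e - c2 e, c1 e + c2 e).
Definition high e : int * int :=
  if 0 <= c2 e then (c0 e - c2 e, c1 e + c2 e) else (c0 e, c1 e).

(** The second case covers corner entries, whose index 0 is not below u when u = 0. *)
Definition index_ok e u a := (a < u)%N || (c2 e == 0).

Lemma low_le e u a : index_ok e u a ->
  (low e).1 + (low e).2 * u%:Z <= small_part e u a.
Proof.
rewrite /low /small_part => /orP[ltau|/eqP->]; last by rewrite lexx /=; lia.
case: ifPn => c2P /=; first by have : 0 <= c2 e * a%:Z by [apply: mulr_ge0]; lia.
have : 0 <= - c2 e * (u%:Z - 1 - a%:Z) by apply: mulr_ge0; lia.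
by lia.
Qed.

Lemma high_ge e u a : index_ok e u a ->
  small_part e u a <= (high e).1 + (high e).2 * u%:Z.
Proof.
rewrite /high /small_part => /orP[ltau|/eqP->]; last by rewrite lexx /=; lia.
case: ifPn => c2P /=; last first.
  by have : 0 <= - c2 e * a%:Z by [apply: mulr_ge0; lia]; lia.
have : 0 <= c2 e * (u%:Z - 1 - a%:Z) by apply: mulr_ge0; lia.
by lia.
Qed.

(** Either the two ranges are separated, and the implication on [big] ensures that adding s keeps
    their order, or both entries shift alike and their values have opposite parity for all
    indices. *)
Definition apart m e e' : bool :=
  [|| affine_lt m (high e) (low e') && (big e ==> big e'),
      affine_lt m (high e') (low e) && (big e' ==> big e) |
      [&& big e == big e', (2 %| c2 e)%Z, (2 %| c2 e')%Z, (2 %| c1 e - c1 e')%Z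
        & ~~ (2 %| c0 e - c0 e')%Z]].

Lemma apartP m e e' u a a' s : apart m e e' -> (m <= u)%N ->
  index_ok e u a -> index_ok e' u a' ->
  magnitude e u a s <> magnitude e' u a' s.
Proof.
move=> + leum ok ok'; have := low_le ok; have := low_le ok'.
have := high_ge ok; have := high_ge ok'; rewrite /magnitude.
move=> h' h l' l /or3P[/andP[/affine_ltP/(_ leum) lt b]|/andP[/affine_ltP/(_ leum) lt b]|].
- by move: b; case: (big e) (big e') => [] []; lia.
- by move: b; case: (big e) (big e') => [] []; lia.
case/and5P=> /eqP<- d2 d2' d1 /negP nd0 eqM; apply: nd0.
have -> : c0 e - c0 e' = c2 e' * a'%:Z - c2 e * a%:Z - (c1 e - c1 e') * u%:Z.
  by move: eqM; rewrite /small_part; lia.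
by rewrite !rpredB ?dvdz_mulr.
Qed.

(** Here t = t0 + t1 u and 3n = 3r + 24u; the added 1 turns upper bounds into strict
    inequalities. *)
Definition in_range m (r t0 t1 : nat) e : bool :=
  if big e then affine_lt m (t0%:Z, t1%:Z) (low e) &&
                affine_lt m (high e) (3 * r%:Z + 1, 24)
  else affine_lt m (0, 0) (low e) && affine_lt m (high e) (t0%:Z + 1, t1%:Z).

Lemma in_rangeP m r t0 t1 e u a s (t := (t0 + t1 * u)%N) :
    in_range m r t0 t1 e -> (m <= u)%N -> index_ok e u a ->
  (0 < magnitude e u a s <= t%:Z) ||
  (t%:Z + s%:Z < magnitude e u a s <= (3 * (8 * u + r) + s)%N%:Z).
Proof.
move=> + leum ok; have := low_le ok; have := high_ge ok.
rewrite /in_range /magnitude; case: ifP => b h l /andP[].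
  move=> /affine_ltP/(_ leum) /= lt1 /affine_ltP/(_ leum) /= lt2.
  by apply/orP; right; rewrite /t; lia.
move=> /affine_ltP/(_ leum) /= lt1 /affine_ltP/(_ leum) /= lt2.
by apply/orP; left; rewrite /t; lia.
Qed.

End Entries.

(** * Block diagonal assembly *)

Definition table := nat -> nat -> option entry.

(* Block a, for a < u, is a copy of T; the corner is a copy of S, with index 0. *)
Definition locate (T S : table) u i j : option (entry * nat) :=
  if (i < 8 * u) && (j < 8 * u) then
    if i %/ 8 == j %/ 8 then omap (pair^~ (i %/ 8)) (T (i %% 8) (j %% 8)) else None
  else if (8 * u <= i) && (8 * u <= j) then
    omap (pair^~ 0) (S (i - 8 * u) (j - 8 * u)) else None.

(** Columns become rows of the transposed tables, so sums are computed for rows only. *)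
Lemma locate_transpose T S u i j :
  locate T S u i j = locate (fun p q => T q p) (fun p q => S q p) u j i.
Proof.
rewrite /locate andbC [in RHS]andbC [X in _ = if _ then _ else if X then _ else _]andbC.
rewrite andbC; case: ifP => // _; rewrite eq_sym; case: eqP => // ->//.
Qed.

Section BlockSums.
Variables (V : Type) (idx : V) (op : Monoid.com_law idx).
Variables (T S : table) (u r : nat) (F : option (entry * nat) -> V).
Hypothesis F0 : F None = idx.

Lemma big_blocks (h : nat -> V) :
  \big[op/idx]_(0 <= j < 8 * u + r) h j =
  op (\big[op/idx]_(0 <= b < u) \big[op/idx]_(0 <= q < 8) h (8 * b + q))
     (\big[op/idx]_(0 <= q < r) h (8 * u + q)).
Proof.
rewrite (big_cat_nat (n := 8 * u)) ?leq_addr //=; congr (op _ _); last first.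
  by rewrite -{1}[8 * u]add0n big_addn addKn; apply: eq_bigr => q _; rewrite addnC.
elim: u => [|v IHv]; first by rewrite muln0 !big_nil.
rewrite [RHS]big_nat_recr // -IHv (big_cat_nat (n := 8 * v)) //=; last by lia.
congr (op _ _); rewrite -{1}[8 * v]add0n big_addn (_ : 8 * v.+1 - 8 * v = 8); last by lia.
by apply: eq_bigr => q _; rewrite addnC.
Qed.

Lemma block_row i : i < 8 * u ->
  \big[op/idx]_(0 <= j < 8 * u + r) F (locate T S u i j) =
  \big[op/idx]_(o <- map (T (i %% 8)) (iota 0 8)) F (omap (pair^~ (i %/ 8)) o).
Proof.
move=> ltiu; rewrite big_blocks [X in op _ X]big_nat [X in op _ X]big1 => [|q qr]; last first.
  by rewrite /locate ltiu !ifF //; lia.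
have iu : i %/ 8 < u by lia.
rewrite Monoid.mulm1 big_map big_mkord (big_only1 (Ordinal iu)) // => [|b bi _]; last first.
  rewrite big_nat big1 // => q q8; rewrite /locate ltiu ifT; last by have := ltn_ord b; lia.
  rewrite ifF //; apply/eqP => E; case/eqP: bi; apply: val_inj => /=; lia.
rewrite [LHS]big_nat [RHS]big_seq_cond.
have E q : q < 8 -> locate T S u i (8 * (i %/ 8) + q) = omap (pair^~ (i %/ 8)) (T (i %% 8) q).
  move=> q8; rewrite /locate ltiu ifT; last by lia.
  by rewrite ifT; [congr (omap _ (T _ _)); lia|apply/eqP; lia].
by rewrite /index_iota subn0; apply: eq_big => q; rewrite ?mem_iota ?andbT // => /E->.
Qed.

Lemma special_row p :
  \big[op/idx]_(0 <= j < 8 * u + r) F (locate T S u (8 * u + p) j) =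
  \big[op/idx]_(o <- map (S p) (iota 0 r)) F (omap (pair^~ 0) o).
Proof.
rewrite big_blocks big_nat big1 => [|b bu]; last first.
  by rewrite big_nat big1 // => q q8; rewrite /locate !ifF //; lia.
rewrite Monoid.mul1m big_map /index_iota subn0; apply: eq_bigr => q _.
by rewrite /locate ifF ?ifT ?addKn //; lia.
Qed.

End BlockSums.

(** * The finite check and the base array it certifies *)

Definition all_cells w (T : table) (P : nat -> nat -> entry -> bool) : bool :=
  all (fun p => all (fun q => if T p q is Some e then P p q e else true) (iota 0 w)) (iota 0 w).

Lemma all_cellsP w T P p q e : all_cells w T P -> p < w -> q < w ->
  T p q = Some e -> P p q e.
Proof.
move=> /allP allT pw qw Te.
have /allP/(_ q) := allT p ltac:(by rewrite mem_iota); rewrite mem_iota Te.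
exact.
Qed.

Definition lines_ok r w (T : table) : bool :=
  all (fun p => line_ok r (map (T p) (iota 0 w)) &&
                line_ok r (map (T^~ p) (iota 0 w))) (iota 0 w).

(* An entry of T occurs only if u >= 1, so comparisons involving T start at u = 1;
   those within S must already hold at u = 0. *)
Definition tables_ok r t0 t1 (T S : table) : bool :=
  [&& lines_ok r 8 T, lines_ok r r S,
      all_cells 8 T (fun p q e => [&& in_band p q, c2 e != 0%R & in_range 1 r t0 t1 e]),
      all_cells r S (fun p q e => [&& in_band p q, c2 e == 0%R & in_range 0 r t0 t1 e]),
      all_cells 8 T (fun p q e => all_cells 8 T (fun p' q' e' =>
        ((p, q) == (p', q')) || apart 1 e e')),
      all_cells 8 T (fun p q e => all_cells r S (fun p' q' e' => apart 1 e e')) &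
      all_cells r S (fun p q e => all_cells r S (fun p' q' e' =>
        ((p, q) == (p', q')) || apart 0 e e'))].

(** For s = 0 this is an H(n;3) inside the band; in general a gap of length s opens after t. With s
    = 4mn and k = 4m + 3 the modulus is 2nk + 1. *)
Definition shiftable (n s t : nat) (B : nat -> nat -> option int) : Prop :=
  [/\ t <= 3 * n,
      (forall i, i < n -> \sum_(0 <= j < n) filled (B i j) = 3 /\
                          \sum_(0 <= j < n) filled (B j i) = 3),
      (forall i, i < n ->
         ((6 * n + 1 + 2 * s)%:Z %| (\sum_(0 <= j < n) cellv (B i j))%R)%Z /\
         ((6 * n + 1 + 2 * s)%:Z %| (\sum_(0 <= j < n) cellv (B j i))%R)%Z),
      (forall i j z, i < n -> j < n -> B i j = Some z ->
         in_band i j /\ ((0 < `|z| <= t) || (t + s < `|z| <= 3 * n + s))) &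
      (forall i j i' j' z z', i < n -> j < n -> i' < n -> j' < n ->
         B i j = Some z -> B i' j' = Some z' -> `|z| = `|z'| -> i = i' /\ j = j')].

Definition base (T S : table) u s i j : option int :=
  omap (fun x => value x.1 u x.2 s) (locate T S u i j).

Variant locate_spec (T S : table) u r i j e a : Prop :=
| InBlock p q of a < u & p < 8 & q < 8 & i = 8 * a + p & j = 8 * a + q & T p q = Some e
| InCorner p q of p < r & q < r & i = 8 * u + p & j = 8 * u + q & S p q = Some e.

Lemma locateP T S u r i j e a : i < 8 * u + r -> j < 8 * u + r ->
  locate T S u i j = Some (e, a) -> locate_spec T S u r i j e a.
Proof.
rewrite /locate => ir jr; case: ifP => [/andP[iu ju]|_].
  case: eqP => // E; case Te: (T _ _) => [e'|] //= [<- <-].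
  by apply: (@InBlock _ _ _ _ _ _ _ _ (i %% 8) (j %% 8)) => //; lia.
case: ifP => // /andP[ui uj]; case Se: (S _ _) => [e'|] //= [<- _].
by apply: (@InCorner _ _ _ _ _ _ _ _ (i - 8 * u) (j - 8 * u)) => //; lia.
Qed.

(** A general monoid serves both the count of filled cells and the sum of entries. *)
Lemma base_row (V : Type) (idx : V) (op : Monoid.com_law idx) (F : option int -> V)
    (T S : table) u r s i :
  lines_ok r 8 T -> lines_ok r r S -> F None = idx -> i < 8 * u + r ->
  exists a l, line_ok r l /\
    \big[op/idx]_(0 <= j < 8 * u + r) F (base T S u s i j) =
    \big[op/idx]_(o <- l) F (omap (fun e => value e u a s) o).
Proof.
move=> /allP lT /allP lS F0 ltin.
pose G (x : option (entry * nat)) := F (omap (fun x => value x.1 u x.2 s) x).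
have [ltiu|leui] := ltnP i (8 * u).
  exists (i %/ 8), (map (T (i %% 8)) (iota 0 8)); split.
    by have /andP[] := lT (i %% 8) ltac:(by rewrite mem_iota ltn_pmod).
  rewrite [LHS](@block_row _ _ op T S u r G) //.
  by apply: eq_bigr => -[].
exists 0, (map (S (i - 8 * u)) (iota 0 r)); split.
  by have /andP[] := lS (i - 8 * u) ltac:(by rewrite mem_iota; move: ltin; lia).
rewrite -{1}(subnKC leui) [LHS](@special_row _ _ op T S u r G) //.
by apply: eq_bigr => -[].
Qed.

Lemma abs_value m r t0 t1 e u a s : in_range m r t0 t1 e -> m <= u -> index_ok e u a ->
  Posz `|value e u a s| = magnitude e u a s.
Proof.
move=> R mu iok; rewrite /value abszMsign.
by have := in_rangeP s R mu iok; lia.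
Qed.

Section Base.
Variables (T S : table) (u r t0 t1 s : nat).
Hypothesis ok : tables_ok r t0 t1 T S.
Let n := 8 * u + r.
Let t := t0 + t1 * u.

Lemma base_entry i j z : i < n -> j < n -> base T S u s i j = Some z ->
  exists e a m, [/\ locate_spec T S u r i j e a, z = value e u a s,
    index_ok e u a, m <= u & in_band i j && in_range m r t0 t1 e].
Proof.
move=> ltin ltjn; rewrite /base; case E: locate => [[e a]|] //= [<-].
have loc := locateP ltin ltjn E; case/and5P: ok => _ _ cT cS _.
exists e, a; case: loc => [p q au p8 q8 -> -> Te|p q pr qr -> -> Se].
  exists 1; have /and3P[b c R] := all_cellsP cT p8 q8 Te.
  split; rewrite /index_ok ?au //; first exact: InBlock Te; first by lia.
  by rewrite R andbT; move: b; rewrite /in_band; lia.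
exists 0; have /and3P[b c R] := all_cellsP cS pr qr Se.
split; rewrite /index_ok ?c ?orbT //; first exact: InCorner Se.
by rewrite R andbT; move: b; rewrite /in_band; lia.
Qed.

Lemma base_inj i j i' j' z z' : i < n -> j < n -> i' < n -> j' < n ->
  base T S u s i j = Some z -> base T S u s i' j' = Some z' ->
  `|z| = `|z'| -> i = i' /\ j = j'.
Proof.
move=> ltin ltjn ltin' ltjn'.
move=> /(base_entry ltin ltjn)[e [a [m [loc -> iok mu /andP[_ R]]]]].
move=> /(base_entry ltin' ltjn')[e' [a' [m' [loc' -> iok' mu' /andP[_ R']]]]].
move/(congr1 Posz); rewrite (abs_value s R) // (abs_value s R') // => eqM.
have disj k : k <= u -> apart k e e' -> False.
  by move=> ku ap; apply: (apartP ap ku iok iok' eqM).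
have disj' k : k <= u -> apart k e' e -> False.
  by move=> ku ap; apply: (apartP ap ku iok' iok (esym eqM)).
case/and5P: ok => _ _ cT _ /and3P[TT TS SS].
case: loc loc' => [p q au p8 q8 -> -> Te|p q pr qr -> -> Se]
  [p' q' au' p8' q8' -> -> Te'|p' q' pr' qr' -> -> Se'].
- have u1 : 1 <= u by lia.
  have /orP[/eqP[pp qq]|/(disj _ u1)//] := all_cellsP (all_cellsP TT p8 q8 Te) p8' q8' Te'.
  have /and3P[_ c _] := all_cellsP cT p8 q8 Te.
  move: eqM; rewrite pp qq Te' in Te *; case: Te => ->; rewrite /magnitude /small_part => eqM.
  (* Two copies of one cell of [T] differ by a multiple of [c2 e], which is nonzero, so the blocks
     coincide. *)
  have : (c2 e * (a%:Z - a'%:Z) = 0)%R by move: eqM; lia.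
  by move/eqP; rewrite mulf_eq0 (negbTE c) /= subr_eq0 => /eqP[->].
- have u1 : 1 <= u by lia.
  by case: (disj 1 u1 (all_cellsP (all_cellsP TS p8 q8 Te) pr' qr' Se')).
- have u1 : 1 <= u by lia.
  by case: (disj' 1 u1 (all_cellsP (all_cellsP TS p8' q8' Te') pr qr Se)).
have /orP[/eqP[-> ->]//|/(disj 0 isT)//] := all_cellsP (all_cellsP SS pr qr Se) pr' qr' Se'.
Qed.

End Base.

Lemma lines_ok_transpose r w T : lines_ok r w T -> lines_ok r w (fun p q => T q p).
Proof. by move=> /allP lT; apply/allP => p /lT; rewrite andbC. Qed.

Lemma base_col T S u s i j :
  base T S u s j i = base (fun p q => T q p) (fun p q => S q p) u s i j.
Proof. by rewrite /base locate_transpose. Qed.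

Lemma tables_shiftable r t0 t1 T S u s : tables_ok r t0 t1 T S ->
  t0 <= 3 * r -> t1 <= 24 ->
  shiftable (8 * u + r) s (t0 + t1 * u) (base T S u s).
Proof.
move=> ok t0r t124; have /and3P[lT lS _] := ok.
have lT' := lines_ok_transpose lT; have lS' := lines_ok_transpose lS.
split; first by have := leq_mul t124 (leqnn u); lia.
- have H T1 S1 i : lines_ok r 8 T1 -> lines_ok r r S1 -> i < 8 * u + r ->
      \sum_(0 <= j < 8 * u + r) filled (base T1 S1 u s i j) = 3.
    move=> lT1 lS1 iu.
    have [a [l [lok ->]]] := @base_row _ _ addn (@filled int) T1 S1 u r s i lT1 lS1 erefl iu.
    by apply: etrans (line_filled lok); apply: eq_bigr => -[].
  move=> i iu; split; first exact: H.
  by apply: etrans (H _ _ i lT' lS' iu); apply: eq_bigr => j _; rewrite base_col.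
- have H T1 S1 i : lines_ok r 8 T1 -> lines_ok r r S1 -> i < 8 * u + r ->
      ((6 * (8 * u + r) + 1 + 2 * s)%:Z %|
         (\sum_(0 <= j < 8 * u + r) cellv (base T1 S1 u s i j))%R)%Z.
    move=> lT1 lS1 iu.
    have [a [l [lok ->]]] := @base_row _ _ (@GRing.add int) cellv T1 S1 u r s i lT1 lS1 erefl iu.
    exact: line_dvd.
  move=> i iu; split; first exact: H.
  by under eq_bigr => j _ do rewrite base_col; exact: H.
- move=> i j z iu ju /(base_entry ok iu ju)[e [a [m [_ -> iok mu /andP[-> R]]]]].
  split=> //; have := in_rangeP s R mu iok; rewrite -(abs_value s R mu iok).
  by lia.
- by move=> i j i' j' z z'; apply: (base_inj ok).
Qed.

(** * Explicit tables for n = 8u + 7 and n = 8u + 11 *)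

Definition table_of (M : seq (seq (option entry))) : table :=
  fun p q => nth None (nth [::] M p) q.

(* The coefficients below were found by a computer search. *)
Definition blocks7 : table := table_of [::
   [:: None; Some (Entry false true 22 22 2); Some (Entry false false 7 7 (-1)); Some (Entry false true 14 19 (-1)); None; None; None; None];
   [:: Some (Entry false false 2 0 2); None; Some (Entry true false 11 9 1); Some (Entry false false 9 9 (-1)); None; None; None; None];
   [:: Some (Entry false true 13 17 (-1)); Some (Entry false false 10 11 (-1)); None; Some (Entry false true 20 20 2); None; None; None; None];
   [:: Some (Entry true true 15 17 1); Some (Entry false true 11 15 (-1)); Some (Entry false false 4 2 2); None; None; None; None; None];
   [:: None; None; None; None; None; Some (Entry true true 17 22 (-2)); Some (Entry true true 14 15 1); Some (Entry true false 12 11 1)];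
   [:: None; None; None; None; Some (Entry false false 1 0 2); None; Some (Entry false true 11 13 (-1)); Some (Entry true true 12 13 1)];
   [:: None; None; None; None; Some (Entry true false 7 5 1); Some (Entry true true 17 19 1); None; Some (Entry true true 19 24 (-2))];
   [:: None; None; None; None; Some (Entry false false 6 5 (-1)); Some (Entry true false 9 7 1); Some (Entry false false 3 2 2); None]]%Z.

Definition corner7 : table := table_of [::
   [:: Some (Entry false true 17 20 0); None; Some (Entry false false 2 2 0); Some (Entry true true 19 22 0); None; None; None];
   [:: Some (Entry false false 4 4 0); None; Some (Entry false false 5 4 0); None; Some (Entry true false 9 8 0); None; None];
   [:: Some (Entry true true 21 24 0); Some (Entry true true 12 15 0); None; None; None; Some (Entry true false 10 9 0); None];
   [:: None; Some (Entry true false 11 11 0); None; None; None; Some (Entry true true 18 20 0); Some (Entry true true 14 17 0)];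
   [:: None; Some (Entry true true 20 22 0); None; Some (Entry true false 8 7 0); None; Some (Entry true true 15 19 0); None];
   [:: None; None; Some (Entry true false 7 6 0); None; Some (Entry false false 6 4 0); None; Some (Entry false false 1 2 0)];
   [:: None; None; None; Some (Entry true true 16 19 0); Some (Entry false false 3 4 0); None; Some (Entry false true 13 15 0)]]%Z.

(** The corner has 11 small entries and each block has 12, whence t = 11 + 12u. *)
Lemma tables7_ok : tables_ok 7 11 12 blocks7 corner7.
Proof. by vm_compute. Qed.

Definition blocks11 : table := table_of [::
   [:: None; Some (Entry true false 6 6 (-2)); Some (Entry true true 16 12 1); Some (Entry false true 22 18 (-1)); None; None; None; None];
   [:: Some (Entry true false 3 4 (-2)); None; Some (Entry false true 17 14 (-1)); Some (Entry true true 14 10 1); None; None; None; None];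
   [:: Some (Entry false true 28 22 (-1)); Some (Entry true true 20 14 1); None; Some (Entry true false 8 8 (-2)); None; None; None; None];
   [:: Some (Entry true true 25 18 1); Some (Entry false true 26 20 (-1)); Some (Entry true false 1 2 (-2)); None; None; None; None; None];
   [:: None; None; None; None; None; Some (Entry false false 9 4 2); Some (Entry true true 29 20 1); Some (Entry false true 20 16 (-1))];
   [:: None; None; None; None; Some (Entry true false 0 2 (-2)); None; Some (Entry false true 31 24 (-1)); Some (Entry true true 31 22 1)];
   [:: None; None; None; None; Some (Entry false true 12 10 (-1)); Some (Entry true true 23 16 1); None; Some (Entry false false 11 6 2)];
   [:: None; None; None; None; Some (Entry true true 12 8 1); Some (Entry false true 14 12 (-1)); Some (Entry true false 2 4 (-2)); None]]%Z.

Definition corner11 : table := table_of [::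
   [:: Some (Entry false true 25 19 0); Some (Entry true false 11 8 0); Some (Entry true true 14 11 0); None; None; None; None; None; None; None; None];
   [:: Some (Entry false false 1 0 0); None; None; Some (Entry true true 19 14 0); Some (Entry false true 18 14 0); None; None; None; None; None; None];
   [:: None; Some (Entry true true 20 15 0); None; None; Some (Entry false false 3 2 0); Some (Entry false true 17 13 0); None; None; None; None; None];
   [:: Some (Entry true true 26 19 0); Some (Entry false true 31 23 0); None; None; None; Some (Entry true false 5 4 0); None; None; None; None; None];
   [:: None; None; Some (Entry true false 2 2 0); Some (Entry false true 29 22 0); None; None; None; Some (Entry true true 27 20 0); None; None; None];
   [:: None; None; Some (Entry false true 16 13 0); None; None; Some (Entry true true 12 9 0); None; None; Some (Entry true false 4 4 0); None; None];
   [:: None; None; None; Some (Entry true false 10 8 0); None; None; Some (Entry false true 23 18 0); None; None; Some (Entry true true 13 10 0); None];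
   [:: None; None; None; None; Some (Entry true true 21 16 0); None; None; None; None; Some (Entry true false 9 6 0); Some (Entry false true 30 22 0)];
   [:: None; None; None; None; None; None; Some (Entry true true 15 12 0); Some (Entry true false 7 4 0); None; Some (Entry false true 22 16 0); None];
   [:: None; None; None; None; None; None; Some (Entry true false 8 6 0); None; Some (Entry false true 32 24 0); None; Some (Entry true true 24 18 0)];
   [:: None; None; None; None; None; None; None; Some (Entry true true 33 24 0); Some (Entry true true 28 20 0); None; Some (Entry true false 6 4 0)]]%Z.

(** The corner has 11 small entries and each block has 8, whence t = 11 + 8u. *)
Lemma tables11_ok : tables_ok 11 11 8 blocks11 corner11.
Proof. by vm_compute. Qed.

(** * Superposition of the base and the filler *)

(** The base lies in the band and the filler outside it, so counts and sums add; the filler's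
    absolute values lie in the gap left by the base. *)
Lemma heffter_of_shiftable n m t B : 4 * m + 7 <= n ->
  shiftable n (4 * m * n) t B -> heffter_exists n (4 * m + 3).
Proof.
move=> mn [t3n cntB sumB bndB injB].
pose A i j := if B i j is Some z then Some z else filler n m t i j.
have disj i j z : i < n -> j < n -> B i j = Some z -> filler n m t i j = None.
  move=> iu ju Bij; case Fij: (filler _ _ _ _ _) => [y|] //.
  by have := filler_offdiag mn iu ju Fij; have [-> _] := bndB _ _ _ iu ju Bij.
have filledA i j : i < n -> j < n ->
    filled (A i j) = filled (B i j) + filled (filler n m t i j).
  by move=> iu ju; rewrite /A; case Bij: (B i j) => [z|] //; rewrite (disj _ _ _ iu ju Bij).
have cellA i j : i < n -> j < n ->
    cellv (A i j) = (cellv (B i j) + cellv (filler n m t i j))%R.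
  move=> iu ju; rewrite /A; case Bij: (B i j) => [z|]; last by rewrite add0r.
  by rewrite (disj _ _ _ iu ju Bij) addr0.
have modE : 2 * n * (4 * m + 3) + 1 = 6 * n + 1 + 2 * (4 * m * n) by lia.
have bndA i j z : i < n -> j < n -> A i j = Some z ->
    B i j = Some z \/ t < `|z| <= t + 4 * m * n /\ filler n m t i j = Some z.
  move=> iu ju; rewrite /A; case: (B i j) => [x|] E; first by left.
  by right; rewrite (filler_bounds mn E).
apply: (heffter_of_fun (A := A)).
- move=> i iu; have [cnt _] := cntB i iu.
  transitivity (\sum_(0 <= j < n) (filled (B i j) + filled (filler n m t i j))).
    by rewrite big_nat [RHS]big_nat; apply: eq_bigr => j /= ju; rewrite filledA.
  by rewrite big_split /= cnt filler_row_count //; lia.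
- move=> i iu; have [_ cnt] := cntB i iu.
  transitivity (\sum_(0 <= j < n) (filled (B j i) + filled (filler n m t j i))).
    by rewrite big_nat [RHS]big_nat; apply: eq_bigr => j /= ju; rewrite filledA.
  by rewrite big_split /= cnt filler_col_count //; lia.
- move=> i iu; have [sum _] := sumB i iu; rewrite modE.
  rewrite (_ : (\sum_(0 <= j < n) _)%R =
     (\sum_(0 <= j < n) (cellv (B i j) + cellv (filler n m t i j)))%R).
    by rewrite big_split /= filler_row_sum // addr0.
  by rewrite big_nat [RHS]big_nat; apply: eq_bigr => j /= ju; rewrite cellA.
- move=> i iu; have [_ sum] := sumB i iu; rewrite modE.
  rewrite (_ : (\sum_(0 <= j < n) _)%R =
     (\sum_(0 <= j < n) (cellv (B j i) + cellv (filler n m t j i)))%R).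
    by rewrite big_split /= filler_col_sum // addr0.
  by rewrite big_nat [RHS]big_nat; apply: eq_bigr => j /= ju; rewrite cellA.
- move=> i j z iu ju /(bndA _ _ _ iu ju)[Bij|[]].
    by have [_] := bndB _ _ _ iu ju Bij; lia.
  by lia.
move=> i j i' j' z z' iu ju iu' ju'.
move=> /(bndA _ _ _ iu ju)[Bij|[zP Fij]] /(bndA _ _ _ iu' ju')[Bij'|[zP' Fij']].
- exact: injB Bij Bij'.
- by have [_] := bndB _ _ _ iu ju Bij; lia.
- by have [_] := bndB _ _ _ iu' ju' Bij'; lia.
exact: (filler_inj mn iu ju iu' ju' Fij Fij').
Qed.

Theorem theorem4p2 (n k : nat) :
  n %% 4 = 3 -> k %% 4 = 3 -> (3 <= k)%N -> (k < n)%N -> heffter_exists n k.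
Proof.
move=> n4 k4 k3 kn; have [m km] : exists m, k = 4 * m + 3 by exists (k %/ 4); lia.
(* Since n and k are congruent modulo 4, k < n gives n >= k + 4. *)
have mn : 4 * m + 7 <= n by lia.
rewrite km.
have [[u nu]|[u nu]] : (exists u, n = 8 * u + 7) \/ (exists u, n = 8 * u + 11).
- have [n8|n8] : n %% 8 = 7 \/ n %% 8 = 3 by lia.
    by left; exists (n %/ 8); lia.
  (* Here n >= 7 and n = 3 modulo 8 force n >= 11, so the subtraction is exact. *)
  by right; exists (n %/ 8 - 1); lia.
- apply: heffter_of_shiftable mn _; rewrite {1}nu; exact: tables_shiftable tables7_ok _ _.
apply: heffter_of_shiftable mn _; rewrite {1}nu; exact: tables_shiftable tables11_ok _ _.
Qed.
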